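(* Let $H$ be a graph with $\alpha^*(H)>\alpha(H)$ and $\alpha^*(H)>\frac{|H|}{2}$. Then for all sufficiently small $c>0$, $H$ is not optimized on the quasi-star or the quasi-clique; that is, there is $c_0>0$ such that for every $c\in(0,c_0)$, $$\limsup_{G\in\mathcal{C}_c\cap\mathcal{Q}}t(H,G)<\mathcal{M}_H(c)\quad\text{and}\quad\limsup_{G\in\mathcal{C}_c\cap\mathcal{S}}t(H,G)<\mathcal{M}_H(c),$$ where $\mathcal{Q}$ is the set of quasi-cliques and $\mathcal{S}$ is the set of quasi-stars.
   Context: Graphs are finite and simple; $|G|$ is the number of vertices of $G$. $\hom(H,G)$ is the number of homomorphisms (edge-preserving vertex maps) from $H$ to $G$ and $t(H,G)=\hom(H,G)/|G|^{|H|}$. $\mathcal{C}_c=\{G:t(K_2,G)\le c\}$. For a class $\mathcal{C}$ of graphs, $\limsup_{G\in\mathcal{C}}f(G)=\lim_{n\to\infty}\sup\{f(G):G\in\mathcal{C},|G|\ge n\}$, and $\mathcal{M}_H(c)=\limsup_{G\in\mathcal{C}_c}t(H,G)$. A quasi-clique is a graph consisting of a clique together with isolated vertices (either part may be empty); a quasi-star is the complement of a quasi-clique. $\alpha(H)$ is the independence number of $H$. The fractional independence number $\alpha^*(H)$ is the maximum of $\sum_{v\in V(H)}w_v$ over all $w\in[0,1]^{V(H)}$ satisfying $w_u+w_v\le 1$ for every edge $uv\in E(H)$.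
   Formalization: The graph H is additionally assumed to have no isolated vertices; without this the claim is false, e.g. for H a triangle plus one isolated vertex, where quasi-cliques attain the maximum. *)

(* Defs.v *)
From HB Require Import structures.
From mathcomp Require Import all_boot all_order all_algebra.
From mathcomp Require Import all_classical all_reals all_analysis.

Set Implicit Arguments.
Unset Strict Implicit.
Unset Printing Implicit Defensive.

Import Order.TTheory GRing.Theory Num.Theory.
Import numFieldNormedType.Exports.

Local Open Scope classical_set_scope.
Local Open Scope ring_scope.

Record sgraph := SGraph {
  vertex :> finType;
  edge : rel vertex;
  edge_sym : symmetric edge;
  edge_irr : irreflexive edge }.

Definition complete_edge n : rel 'I_n := fun u v => u != v.

Lemma complete_edge_sym n : symmetric (@complete_edge n).
Proof. by move=> u v; rewrite /complete_edge eq_sym. Qed.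

Lemma complete_edge_irr n : irreflexive (@complete_edge n).
Proof. by move=> u; rewrite /complete_edge eqxx. Qed.

Definition complete_graph n : sgraph :=
  SGraph (@complete_edge_sym n) (@complete_edge_irr n).

Definition compl_edge (G : sgraph) : rel G :=
  fun u v => (u != v) && ~~ edge u v.

Lemma compl_edge_sym (G : sgraph) : symmetric (@compl_edge G).
Proof. by move=> u v; rewrite /compl_edge eq_sym edge_sym. Qed.

Lemma compl_edge_irr (G : sgraph) : irreflexive (@compl_edge G).
Proof. by move=> u; rewrite /compl_edge eqxx. Qed.

Definition compl_graph (G : sgraph) : sgraph :=
  SGraph (@compl_edge_sym G) (@compl_edge_irr G).

Definition is_hom (H G : sgraph) (f : {ffun H -> G}) : bool :=
  [forall u, forall v, edge u v ==> edge (f u) (f v)].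

Definition hom_count (H G : sgraph) : nat := #|[pred f | @is_hom H G f]|.

Definition hom_density (R : realType) (H G : sgraph) : R :=
  (hom_count H G)%:R / #|G|%:R ^+ #|H|.

(* Classes of graphs are plain predicates because [set sgraph] is a universe
   inconsistency. *)
Definition graph_class := sgraph -> Prop.

Definition class_cap (C D : graph_class) : graph_class :=
  fun G => C G /\ D G.

Definition density_le (R : realType) (c : R) : graph_class :=
  fun G => hom_density R (complete_graph 2) G <= c.

(* The supremum is taken in the extended reals, so that the limit of this
   nonincreasing sequence always exists. *)
Definition limsup_class (R : realType) (C : graph_class)
    (f : sgraph -> R) : \bar R :=
  limn (fun n : nat =>
    ereal_sup
      [set x | exists G : sgraph, [/\ C G, (n <= #|G|)%N & x = (f G)%:E]]).

Definition max_density (R : realType) (H : sgraph) (c : R) : \bar R :=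
  limsup_class (density_le c) (hom_density R H).

Definition quasi_clique : graph_class :=
  fun G => exists A : {set G}, forall u v : G,
    edge u v = [&& u != v, u \in A & v \in A].

Definition quasi_star : graph_class :=
  fun G => quasi_clique (compl_graph G).

Definition independent (H : sgraph) (A : {set H}) : bool :=
  [forall u in A, forall v in A, ~~ edge u v].

Definition alpha (H : sgraph) : nat :=
  \max_(A : {set H} | independent A) #|A|.

Definition fractional_independent (R : realType) (H : sgraph)
    (w : H -> R) : Prop :=
  (forall v, 0 <= w v <= 1) /\ (forall u v, edge u v -> w u + w v <= 1).

(* The set is nonempty and compact, so its supremum in R is its maximum. *)
Definition alpha_star (R : realType) (H : sgraph) : R :=
  sup [set \sum_(v : H) w v | w in @fractional_independent R H].

(* Main.v *)
(* Write h = |H|. For small c a quasi-clique of edge density c has a clique on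
   about sqrt c * n vertices, so t(H, -) = O(c^(h/2)) as H has no isolated
   vertex; a quasi-star has an independent part whose complement has at most
   2 c n vertices, and the preimage of that part under a homomorphism is
   independent in H, so t(H, -) = O(c^(h - alpha)).  Conversely, let w be a
   fractional independent set of total weight s.  Replacing each vertex v of
   H by c^(1 - w v) n vertices gives a graph on h n vertices, with edge density at
   most c since w u + w v <= 1 on edges, and t(H, -) >= (2 h)^-h c^(h - s).
   Taking s > max (alpha, h/2) makes this the dominant term as c tends to 0. *)
Require Import Defs.
From mathcomp Require Import all_boot all_order all_algebra.
From mathcomp Require Import all_classical all_reals all_analysis.
From mathcomp Require Import ring lra.

Import Order.TTheory GRing.Theory Num.Theory.
Import numFieldNormedType.Exports.

Local Open Scope classical_set_scope.
Local Open Scope ring_scope.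

(** * Limits superior over graph classes *)

(** The families shrink as [n] grows, so their suprema are nonincreasing and converge in the
    extended reals to their infimum. *)
Lemma limsup_classE (R : realType) (C : graph_class) (f : sgraph -> R) :
  limsup_class C f = ereal_inf (range (fun n : nat => ereal_sup
    [set x | exists G : sgraph, [/\ C G, (n <= #|G|)%N & x = (f G)%:E]])).
Proof.
apply/cvg_lim => //; apply: ereal_nonincreasing_cvgn => m n le_mn.
apply: ereal_sup_le => x [G [CG nG ->]]; exists G; split => //.
exact: leq_trans nG.
Qed.

Lemma limsup_class_le (R : realType) (C : graph_class) (f : sgraph -> R)
    (U : R) (N : nat) :
  (forall G : sgraph, C G -> (N <= #|G|)%N -> f G <= U) ->
  (limsup_class C f <= U%:E)%E.
Proof.
move=> fU; rewrite limsup_classE; apply: le_trans (ereal_inf_lbound _) _.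
  by exists N.
by apply: ge_ereal_sup => x [G [CG NG ->]]; rewrite lee_fin; apply: fU.
Qed.

Lemma limsup_class_ge (R : realType) (C : graph_class) (f : sgraph -> R)
    (L : R) :
  (forall N : nat, exists G : sgraph, [/\ C G, (N <= #|G|)%N & L <= f G]) ->
  (L%:E <= limsup_class C f)%E.
Proof.
move=> Lf; rewrite limsup_classE; apply: le_ereal_inf_tmp => _ [N _ <-].
have [G [CG NG LG]] := Lf N.
apply: (@le_trans _ _ (f G)%:E); first by rewrite lee_fin.
by apply: ereal_sup_ubound; exists G.
Qed.

(** * Homomorphism counts in quasi-cliques and quasi-stars *)

Lemma hom_count_K2 (G : sgraph) :
  hom_count (complete_graph 2) G = (\sum_(x : G) #|[pred y : G | edge x y]|)%N.
Proof.
under eq_bigr do rewrite -sum1_card.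
rewrite pair_big_dep /= /hom_count -sum1_card.
pose F (p : G * G) : {ffun complete_graph 2 -> G} :=
  [ffun i : complete_graph 2 => if (i : 'I_2) == ord0 then p.1 else p.2].
rewrite (reindex F) /=; last first.
  exists (fun f : {ffun complete_graph 2 -> G} =>
    (f (ord0 : 'I_2), f (ord_max : 'I_2))).
  - by move=> [x y] _; rewrite /F !ffunE.
  - move=> f _; apply/ffunP => i; rewrite ffunE.
    by case: ifP => [/eqP -> //|/negP i0]; congr (f _); apply/val_inj;
      case: i i0 => [[|[|]]].
apply: eq_bigl => -[x y] /=; rewrite unfold_in /=.
apply/forallP/idP => [/(_ (ord0 : 'I_2))/forallP/(_ (ord_max : 'I_2))|xy u].
  by rewrite /F !ffunE.
apply/forallP => v; apply/implyP; rewrite /F !ffunE /=.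
case: u v => [[|[|]]// i] [[|[|]]// j] //=.
by rewrite edge_sym.
Qed.

Lemma hom_count_quasi_clique (H G : sgraph) (A : {set G})
    (h_iso : forall v : H, exists u : H, edge u v)
    (GA : forall u v : G, edge u v = [&& u != v, u \in A & v \in A]) :
  (hom_count H G <= #|A| ^ #|H|)%N.
Proof.
rewrite -card_ffun_on; apply/subset_leq_card/fintype.subsetP => f /forallP fhom.
apply/ffun_onP => v; have [u uv] := h_iso v.
by move: (fhom u) => /forallP/(_ v); rewrite uv GA => /and3P[].
Qed.

Lemma quasi_clique_edges {G : sgraph} {A : {set G}}
    (GA : forall u v : G, edge u v = [&& u != v, u \in A & v \in A]) :
  (#|A| * #|A|.-1 <= hom_count (complete_graph 2) G)%N.
Proof.
rewrite hom_count_K2 -sum_nat_const [leqRHS](bigID (mem A)) /=.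
apply: leq_trans (leq_addr _ _); apply: leq_sum => x xA.
rewrite (cardsD1 x A) xA /=; apply/subset_leq_card/fintype.subsetP => y.
by rewrite !inE GA xA eq_sym.
Qed.

(** A vertex outside [A] is isolated in the complement, hence adjacent in [G] to all other
    vertices. *)
Lemma quasi_star_edges {G : sgraph} {A : {set G}}
    (GA : forall u v : compl_graph G,
      edge u v = [&& u != v, u \in A & v \in A]) :
  (#|~: A| * #|G|.-1 <= hom_count (complete_graph 2) G)%N.
Proof.
rewrite hom_count_K2 -sum_nat_const [leqRHS](bigID (mem (~: A))) /=.
apply: leq_trans (leq_addr _ _); apply: leq_sum => x.
rewrite -(cardsC1 x) inE => xA; apply/subset_leq_card/fintype.subsetP => y.
rewrite !inE eq_sym => xy.
by have := GA x y; rewrite xy (negbTE xA) /= /compl_edge xy => /negbFE.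
Qed.

Lemma card_family_prod (aT rT : finType) (F : aT -> pred rT) :
  #|family F| = (\prod_(x : aT) #|F x|)%N.
Proof. by rewrite card_family foldrE big_image; apply: eq_bigl. Qed.

(** Homomorphisms are grouped by the preimage [S] of [A], which is independent because [A] is
    independent in [G]; vertices not in [S] must land outside [A]. *)
Lemma hom_count_quasi_star (H G : sgraph) (A : {set G})
    (GA : forall u v : compl_graph G,
      edge u v = [&& u != v, u \in A & v \in A]) :
  (hom_count H G <=
    \sum_(S : {set H} | independent S) #|G| ^ #|S| * #|~: A| ^ (#|H| - #|S|))%N.
Proof.
(* Vertices of [S] may go anywhere, not only into [A], so that [family (B S)] has exactly the size
   of the summand for [S]. *)
pose B (S : {set H}) v := [pred x : G | (v \in S) || (x \notin A)].
pose E (f : {ffun H -> G}) : {set H} := [set v | f v \in A]%SET.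
have -> : hom_count H G = (\sum_(f : {ffun H -> G} | is_hom f) 1)%N.
  by rewrite sum1_card.
rewrite (partition_big E (fun S => independent S)) /=; last first.
  move=> f /forallP fhom; apply/forall_inP => u; rewrite inE => uA.
  apply/forall_inP => v; rewrite inE => vA; apply/negP => uv.
  have := forallP (fhom u) v; rewrite uv /= => fuv.
  (* Adjacent images in [A] would have to coincide, giving a loop. *)
  have := GA (f u) (f v); rewrite uA vA andbT /= /compl_edge fuv andbF andbT.
  by move=> /esym/negbFE/eqP fE; move: fuv; rewrite fE edge_irr.
apply: leq_sum => S _.
have -> : (#|G| ^ #|S| * #|~: A| ^ (#|H| - #|S|) = #|family (B S)|)%N.
  rewrite card_family_prod (bigID (mem S)) /=; congr (_ * _)%N.
    rewrite -prod_nat_const; apply: eq_bigr => v vS.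
    by apply: eq_card => x; rewrite !inE vS.
  rewrite -[#|H|](cardsC S) addKn -prod_nat_const.
  rewrite [RHS](eq_bigl (mem (~: S))); last by move=> v; rewrite !inE.
  apply: eq_bigr => v; rewrite inE => vS.
  by apply: eq_card => x; rewrite !inE (negbTE vS).
rewrite sum1_card; apply/subset_leq_card/fintype.subsetP => f.
rewrite unfold_in => /andP[_ /eqP <-]; apply/familyP => v.
by rewrite !inE orbN.
Qed.

(** * Blow-ups of [H] *)

Definition blowup_edge (H : sgraph) (n : nat) (m : H -> nat) :
    rel (H * 'I_n)%type :=
  fun x y => [&& edge x.1 y.1, (x.2 < m x.1)%N & (y.2 < m y.1)%N].

Lemma blowup_edge_sym (H : sgraph) (n : nat) (m : H -> nat) :
  symmetric (blowup_edge H n m).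
Proof. by move=> x y; rewrite /blowup_edge edge_sym (andbC (_ < _)%N). Qed.

Lemma blowup_edge_irr (H : sgraph) (n : nat) (m : H -> nat) :
  irreflexive (blowup_edge H n m).
Proof. by move=> x; rewrite /blowup_edge edge_irr. Qed.

(* The vertex v of H is blown up into an independent class of size m v, and the
   remaining vertices (v, i), m v <= i < n, are isolated. *)
Definition blowup (H : sgraph) (n : nat) (m : H -> nat) : sgraph :=
  SGraph (blowup_edge_sym H n m) (blowup_edge_irr H n m).

Lemma card_blowup (H : sgraph) (n : nat) (m : H -> nat) :
  #|blowup H n m| = (#|H| * n)%N.
Proof. by rewrite card_prod card_ord. Qed.

Lemma card_ord_lt (n k : nat) :
  (k <= n)%N -> #|[pred i : 'I_n | (i < k)%N]| = k.
Proof.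
move=> kn; rewrite -sum1_card.
by rewrite (big_ord_narrow kn) sum1_card card_ord.
Qed.

Lemma blowup_edges (H : sgraph) (n : nat) (m : H -> nat) :
  (forall v, m v <= n)%N ->
  hom_count (complete_graph 2) (blowup H n m) =
    (\sum_(u : H) \sum_(v : H | edge u v) m u * m v)%N.
Proof.
move=> le_mn; rewrite hom_count_K2; under eq_bigr do rewrite -sum1_card.
transitivity (\sum_(u : H) \sum_(i < n) \sum_(v : H) \sum_(j < n |
  [&& edge u v, (i < m u)%N & (j < m v)%N]) 1)%N.
  rewrite pair_big; apply: eq_bigr => -[u i] _ /=.
  by rewrite pair_big_dep.
apply: eq_bigr => u _; rewrite exchange_big [RHS]big_mkcond /=.
apply: eq_bigr => v _; case: ifP => uv /=; last first.
  by rewrite big1 // => i _; rewrite big_pred0.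
rewrite -{2}(card_ord_lt _ _ (le_mn u)) -sum_nat_const [RHS]big_mkcond /=.
apply: eq_bigr => i _; rewrite inE; case: ifP => iu /=.
  by rewrite sum1_card (card_ord_lt _ _ (le_mn v)).
by rewrite big_pred0.
Qed.

(** Any map sending each vertex [v] into its own class is a homomorphism. *)
Lemma hom_count_blowup (H : sgraph) (n : nat) (m : H -> nat) :
  (forall v, m v <= n)%N ->
  (\prod_(v : H) m v <= hom_count H (blowup H n m))%N.
Proof.
move=> le_mn.
pose B (v : H) := [pred x : blowup H n m | (x.1 == v) && (x.2 < m v)%N].
have -> : (\prod_(v : H) m v = #|family B|)%N.
  rewrite card_family_prod; apply: eq_bigr => v _.
  rewrite -(card_ord_lt _ _ (le_mn v)) -[LHS]mul1n -(card1 v) -cardX.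
  by apply: eq_card => x; rewrite !inE.
apply/subset_leq_card/fintype.subsetP => f /familyP fB.
apply/forallP => u; apply/forallP => v; apply/implyP => uv.
have := fB u; have := fB v; rewrite !inE => /andP[/eqP fv vm] /andP[/eqP fu um].
by rewrite /edge /= /blowup_edge fu fv uv um vm.
Qed.

(** * The density constraint and the two upper bounds *)

Lemma density_leE (R : realType) (c : R) (G : sgraph) : (0 < #|G|)%N ->
  density_le c G <-> (hom_count (complete_graph 2) G)%:R <= c * #|G|%:R ^+ 2.
Proof.
move=> G0; rewrite /density_le /hom_density card_ord ler_pdivrMr //.
by rewrite exprn_gt0 // ltr0n.
Qed.

Lemma limsup_quasi_clique (R : realType) (H : sgraph) (c : R) :
  (forall v : H, exists u : H, edge u v) -> 0 < c ->
  (limsup_class (class_cap (density_le c) quasi_clique) (hom_density R H)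
     <= (2 ^+ #|H| * c `^ (#|H|%:R / 2))%:E)%E.
Proof.
move=> h_iso c0; pose s := Num.sqrt c.
have s0 : 0 < s by rewrite sqrtr_gt0.
have sE : s ^+ 2 = c by rewrite sqr_sqrtr // ltW.
(* The bound ensures [1 <= s * #|G|]; the successor makes [G] nonempty. *)
apply: (limsup_class_le _ _ _ _ (Num.bound s^-1).+1) => G [cG [A GA]] NG.
have G0 : (0 < #|G|)%N by exact: leq_trans NG.
have n0 : 0 < #|G|%:R :> R by rewrite ltr0n.
have sn1 : 1 <= s * #|G|%:R.
  rewrite mulrC -ler_pdivrMr // div1r.
  apply/ltW/(lt_le_trans (archi_boundP _)); first by rewrite invr_ge0 ltW.
  by rewrite ler_nat ltnW.
have aA : #|A|%:R <= 2 * s * #|G|%:R.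
  have [->|A0] := posnP #|A|; first by rewrite !mulr_ge0 // ltW.
  have := cG; rewrite (density_leE _ _ _ G0) -sE -exprMn => edges.
  have : #|A|%:R * (#|A|%:R - 1) <= (s * #|G|%:R) ^+ 2.
    apply: le_trans edges.
    rewrite -[1 in X in X <= _]/(1%:R) -natrB // subn1 -natrM ler_nat.
    exact: quasi_clique_edges.
  rewrite -mulrA; move: (s * _) sn1 => x x1 ax.
  have a1 : (1 : R) <= #|A|%:R by rewrite ler1n.
  (* If a > 2x with x >= 1, then a - 1 > x and a(a - 1) > 2x^2, contradicting the edge bound. *)
  by rewrite leNgt; apply/negP => ?; nra.
rewrite /hom_density ler_pdivrMr ?exprn_gt0 //.
apply: (@le_trans _ _ (#|A|%:R ^+ #|H|)).
  by rewrite -natrX ler_nat hom_count_quasi_clique.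
have -> : c `^ (#|H|%:R / 2) = s ^+ #|H|.
  by rewrite mulrC powRrM powR12_sqrt ?powR_mulrn // ltW.
by rewrite -!exprMn lerXn2r // nnegrE // !mulr_ge0 // ltW.
Qed.

Lemma leq_alpha (H : sgraph) (S : {set H}) :
  independent S -> (#|S| <= alpha H)%N.
Proof. exact: (leq_bigmax_cond (F := fun A : {set H} => #|A|)). Qed.

Lemma alpha_le_card (H : sgraph) : (alpha H <= #|H|)%N.
Proof. by apply/bigmax_leqP => S _; apply: max_card. Qed.

(** Since 2c <= 1 and [#|S| <= alpha H], each summand of [hom_count_quasi_star] is at most (2c)^(h -
    alpha) n^h, where h = |H| and n = |G|. *)
Lemma limsup_quasi_star (R : realType) (H : sgraph) (c : R) :
  0 < c -> c <= 1 / 2 ->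
  (limsup_class (class_cap (density_le c) quasi_star) (hom_density R H)
     <= (4 ^+ #|H| * c `^ (#|H|%:R - (alpha H)%:R))%:E)%E.
Proof.
(* From order 2 on, n - 1 >= n/2, which costs the factor 2 in [bB]. *)
move=> c0 c1; apply: (limsup_class_le _ _ _ _ 2) => G [cG [A GA]] NG.
have G0 : (0 < #|G|)%N by exact: leq_trans NG.
have n0 : 0 < #|G|%:R :> R by rewrite ltr0n.
have bB : #|~: A|%:R <= 2 * c * #|G|%:R.
  have := cG; rewrite (density_leE _ _ _ G0) => edges.
  have : #|~: A|%:R * (#|G|%:R - 1) <= c * #|G|%:R ^+ 2.
    apply: le_trans edges.
    rewrite -[1 in X in X <= _]/(1%:R) -natrB // subn1 -natrM ler_nat.
    exact: quasi_star_edges.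
  have n2 : (2 : R) <= #|G|%:R by rewrite ler_nat.
  have b0 : (0 : R) <= #|~: A|%:R by [].
  rewrite expr2 => bn.
  have : #|~: A|%:R * (#|G|%:R / 2) <= c * #|G|%:R * #|G|%:R by nra.
  rewrite mulrA ler_pdivrMr // => {}bn.
  by rewrite -(ler_pM2r n0); nra.
rewrite /hom_density ler_pdivrMr ?exprn_gt0 //.
pose T : R := (2 * c) ^+ (#|H| - alpha H).
have T0 : 0 <= T by rewrite exprn_ge0 // mulr_ge0 // ltW.
apply: (@le_trans _ _
  (\sum_(S : {set H} | independent S) T * #|G|%:R ^+ #|H|)).
  apply: (@le_trans _ _ (\sum_(S : {set H} | independent S)
     #|G| ^ #|S| * #|~: A| ^ (#|H| - #|S|))%N%:R).
    by rewrite ler_nat hom_count_quasi_star.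
  rewrite natr_sum; apply: ler_sum => S indS; rewrite natrM !natrX.
  have SH : (#|S| <= #|H|)%N by apply: max_card.
  rewrite -{2}(subnKC SH) exprD mulrCA ler_wpM2l ?exprn_ge0 //.
  apply: (@le_trans _ _ ((2 * c * #|G|%:R) ^+ (#|H| - #|S|))).
    by rewrite lerXn2r // nnegrE // !mulr_ge0 // ltW.
  rewrite exprMn ler_wpM2r ?exprn_ge0 //.
  rewrite ler_wiXn2l ?mulr_ge0 ?(ltW c0) //; first by lra.
  by rewrite leq_sub2l // leq_alpha.
rewrite -mulr_suml ler_wpM2r ?exprn_ge0 // sumr_const.
have -> : c `^ (#|H|%:R - (alpha H)%:R) = c ^+ (#|H| - alpha H).
  by rewrite -natrB ?alpha_le_card // powR_mulrn // ltW.
apply: (@le_trans _ _ (T *+ 2 ^ #|H|)).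
  rewrite ler_wpMn2l //.
  rewrite -[#|H|]cardsT -card_powerset.
  apply/subset_leq_card/fintype.subsetP => S _.
  by rewrite powersetE finset.subsetT.
rewrite -[leLHS]mulr_natr natrX /T exprMn mulrAC
  ler_wpM2r ?exprn_ge0 ?(ltW c0) //.
(* One factor 2^h counts the sets [S]; the other absorbs 2^(h - alpha). *)
have -> : (4 : R) = 2 * 2 by ring.
rewrite exprMn ler_wpM2r ?exprn_ge0 // ler_weXn2l ?leq_subr //.
by lra.
Qed.

(** * Lower bound from a fractional independent set *)

Lemma prod_powR (R : realType) (I : finType) (c : R) (F : I -> R) : 0 < c ->
  \prod_(i : I) c `^ F i = c `^ (\sum_(i : I) F i).
Proof.
move=> c0; apply/esym; apply: (big_morph (fun x => c `^ x)); last exact: powRr0.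
by move=> x y; rewrite powRD // (gt_eqF c0) implybT.
Qed.

(** In the constant (2h)^-h, each vertex of [H] contributes a factor 1/2 for rounding its class size
    down and 1/h for the order hn of the blow-up. *)
Lemma max_density_ge (R : realType) (H : sgraph) (w : H -> R) (c : R) :
  (0 < #|H|)%N -> fractional_independent w -> 0 < c -> c <= 1 ->
  (((2 * #|H|%:R) ^- #|H| * c `^ (#|H|%:R - \sum_(v : H) w v))%:E
     <= max_density H c)%E.
Proof.
move=> H0 [w01 wE] c0 c1; apply: limsup_class_ge => N.
(* Taking n >= 1/c gives cn >= 1, so every target class size [x v] is at least 1. *)
pose n := maxn N (Num.bound c^-1).
have cn1 : 1 <= c * n%:R.
  rewrite mulrC -ler_pdivrMr // div1r.
  apply/ltW/(lt_le_trans (archi_boundP _)); first by rewrite invr_ge0 ltW.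
  by rewrite ler_nat leq_maxr.
have n0 : 0 < n%:R :> R by rewrite -(pmulr_rgt0 _ c0) (lt_le_trans _ cn1).
have h0 : 0 < #|H|%:R :> R by rewrite ltr0n.
pose x v : R := c `^ (1 - w v) * n%:R.
pose m v := Num.truncn (x v).
have x1 v : 1 <= x v.
  apply: le_trans cn1 _; rewrite ler_wpM2r ?(ltW n0) //.
  rewrite -[leLHS]powRr1 ?(ltW c0) // ger_powR ?c0 //.
  by have /andP[] := w01 v; lra.
have xn v : x v <= n%:R.
  rewrite ger_pMl // -[leRHS](powRr0 c) ger_powR ?c0 //.
  by have /andP[] := w01 v; lra.
have x0 v : 0 <= x v by apply: le_trans (x1 v).
have mx v : (m v)%:R <= x v by have /andP[] := truncn_itv (x0 v).
(* Rounding down a real that is at least 1 loses at most half of it. *)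
have xm v : x v <= 2 * (m v)%:R.
  have /andP[_ /ltW] := truncn_itv (x0 v); rewrite -natr1.
  have : (1 : R) <= (m v)%:R.
    by rewrite ler1n -[(0 < _)%N]/(1 <= _)%N truncn_ge_nat.
  by rewrite -/(m v); lra.
have mn v : (m v <= n)%N by rewrite -(ler_nat R) (le_trans (mx v)).
have G0 : 0 < #|blowup H n m|%:R :> R by rewrite card_blowup natrM mulr_gt0.
exists (blowup H n m); split.
- rewrite density_leE -?(ltr0n R) // blowup_edges // natr_sum.
  (* Summing over all h^2 ordered pairs, not only the edges, gives exactly c(hn)^2. *)
  apply: (@le_trans _ _ (\sum_(u : H) \sum_(v : H) c * n%:R ^+ 2)); last first.
    rewrite !sumr_const -mulrnA -[leLHS]mulr_natr card_blowup !natrM le_eqVlt.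
    by apply/orP; left; apply/eqP; ring.
  apply: ler_sum => u _; rewrite natr_sum [leLHS]big_mkcond /=.
  apply: ler_sum => v _; case: ifP => uv; last first.
    by rewrite mulr_ge0 ?exprn_ge0 // ltW.
  rewrite natrM; apply: (@le_trans _ _ (x u * x v)); first exact: ler_pM.
  rewrite /x mulrACA -expr2 ler_wpM2r ?exprn_ge0 //.
  rewrite -powRD ?(gt_eqF c0) ?implybT // -[leRHS]powRr1 ?(ltW c0) //.
  by rewrite ger_powR ?c0 //; have := wE u v uv; lra.
- rewrite card_blowup; apply: (@leq_trans n); first exact: leq_maxl.
  exact: leq_pmull.
rewrite /hom_density ler_pdivlMr ?exprn_gt0 //.
apply: (@le_trans _ _ (\prod_(v : H) (m v)%:R)); last first.
  by rewrite -natr_prod ler_nat hom_count_blowup.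
apply: (@le_trans _ _ (\prod_(v : H) (x v / 2))); last first.
  by apply: ler_prod => v _; have := xm v; have := x0 v; lra.
rewrite card_blowup natrM le_eqVlt; apply/orP; left; apply/eqP.
have -> : #|H|%:R - \sum_(v : H) w v = \sum_(v : H) (1 - w v).
  by rewrite sumrB sumr_const.
under [RHS]eq_bigr do rewrite -mulrA.
rewrite [RHS]big_split /= -prod_powR // prodr_const mulrAC -exprVn -exprMn mulrC.
by congr (_ * _ ^+ _); field; rewrite gt_eqF.
Qed.

(** * Comparison of the exponents for small [c] *)

Lemma powR_small (R : realType) (d K : R) : 0 < d -> 0 < K ->
  exists2 c0 : R, 0 < c0 & forall c, 0 < c -> c < c0 -> c `^ d < K.
Proof.
move=> d0 K0; exists (K `^ d^-1); first exact: powR_gt0.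
move=> c c0 cK; have -> : K = (K `^ d^-1) `^ d.
  by rewrite -powRrM mulVf ?gt_eqF // powRr1 // ltW.
by apply: gt0_ltr_powR => //; rewrite nnegrE ltW // powR_gt0.
Qed.

Theorem theorem4p2 (R : realType) (H : sgraph)
  (h_iso : forall v : H, exists u : H, edge u v)
  (h_alpha : (alpha H)%:R < alpha_star R H)
  (h_half : #|H|%:R / 2 < alpha_star R H) :
  exists c0 : R, 0 < c0 /\
    forall c : R, 0 < c -> c < c0 ->
      (limsup_class (class_cap (density_le c) quasi_clique) (hom_density R H)
         < max_density H c)%E /\
      (limsup_class (class_cap (density_le c) quasi_star) (hom_density R H)
         < max_density H c)%E.
Proof.
(* A single weighting beats both bounds: it is chosen above their maximum, which lies strictly below
   the supremum. The zero weighting shows that the supremum is over a nonempty set. *)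
have [w ww [w_alpha w_half]] : exists2 w : H -> R, fractional_independent w &
    (alpha H)%:R < \sum_(v : H) w v /\ #|H|%:R / 2 < \sum_(v : H) w v.
  have fr0 : fractional_independent (fun _ : H => 0 : R).
    by split=> *; rewrite ?addr0 ?lexx ler01.
  have : Num.max (alpha H)%:R (#|H|%:R / 2) < alpha_star R H.
    by rewrite gt_max h_alpha.
  case/sup_gt; first by exists (\sum_(v : H) 0), (fun=> 0).
  by move=> _ [w ww <-]; rewrite gt_max => /andP[]; exists w.
set s := \sum_(v : H) w v in w_alpha w_half.
have H0 : (0 < #|H|)%N.
  rewrite lt0n; apply/eqP => H0; move: w_half.
  by rewrite /s big_pred0 ?H0 ?mul0r ?ltxx //; apply: card0_eq.
pose K : R := (2 * #|H|%:R) ^- #|H|.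
have K0 : 0 < K by rewrite invr_gt0 exprn_gt0 // mulr_gt0 // ltr0n.
(* Here e is h/2 or alpha. The gap s - e > 0 in the exponent outweighs the constants once [c] is
   small. *)
have strict c (q e : R) : 0 < c -> 0 < q -> c `^ (s - e) < K / q ->
    q * c `^ (#|H|%:R - e) < K * c `^ (#|H|%:R - s).
  move=> c0 q0 cK; have -> : #|H|%:R - e = (s - e) + (#|H|%:R - s) by ring.
  rewrite powRD ?(gt_eqF c0) ?implybT // mulrA ltr_pM2r ?powR_gt0 //.
  by rewrite mulrC -ltr_pdivlMr.
have [c1 c1_gt0 cc1] : exists2 c1 : R, 0 < c1 &
    forall c, 0 < c -> c < c1 -> c `^ (s - #|H|%:R / 2) < K / 2 ^+ #|H|.
  by apply: powR_small; rewrite ?subr_gt0 // divr_gt0 // exprn_gt0.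
have [c2 c2_gt0 cc2] : exists2 c2 : R, 0 < c2 &
    forall c, 0 < c -> c < c2 -> c `^ (s - (alpha H)%:R) < K / 4 ^+ #|H|.
  by apply: powR_small; rewrite ?subr_gt0 // divr_gt0 // exprn_gt0.
(* The bound 1/2 serves the quasi-star estimate and also gives [c <= 1] for the lower bound. *)
exists (Num.min (1 / 2) (Num.min c1 c2)); split.
  by rewrite !lt_min c1_gt0 c2_gt0 divr_gt0.
move=> c c0; rewrite !lt_min => /and3P[c_half lt_c1 lt_c2].
have c_le1 : c <= 1 by lra.
split; apply: lt_le_trans (max_density_ge _ _ _ c H0 ww c0 c_le1).
- apply: le_lt_trans (limsup_quasi_clique _ _ _ h_iso c0) _; rewrite lte_fin.
  have -> : #|H|%:R / 2 = #|H|%:R - #|H|%:R / 2 :> R by field.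
  by apply: strict (cc1 _ c0 lt_c1); rewrite ?exprn_gt0.
- apply: le_lt_trans (limsup_quasi_star _ _ _ c0 (ltW c_half)) _.
  by rewrite lte_fin; apply: strict (cc2 _ c0 lt_c2); rewrite ?exprn_gt0.
Qed.
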